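(* Let $(D,\omega)$ be a pwls-digraph. Then the following statements are equivalent: (i) The characteristic polynomial of $A(D,\omega')$ is the same for every skew-signing $\omega'$ of $(D,\omega)$. (ii) $D$ has no (directed) cycles of even length greater than $2$, and $A(D,\omega)=\Delta^{-1}S\Delta$ where $S$ is a nonnegative symmetric matrix with zero diagonal and $\Delta$ is a diagonal matrix with positive diagonal entries.
   Context: A digraph $D=(V,E)$ is finite, with arcs being ordered pairs $uv$ of vertices. $D$ is loopless if it has no arc $uu$, and symmetric if $uv\in E$ implies $vu\in E$. An arc-weighted digraph $(D,\omega)$ has $\omega$ assigning a nonzero real number $\omega(uv)$ to each arc. A pwls-digraph is an arc-weighted digraph $(D,\omega)$ with $D$ loopless and symmetric and $\omega(uv)>0$ for every arc. For vertices $v_1,\dots,v_n$, the weighted adjacency matrix $A(D,\omega)=[a_{ij}]$ has $a_{ij}=\omega(v_iv_j)$ if $v_iv_j$ is an arc and $0$ otherwise. A skew-signing of a pwls-digraph $(D,\omega)$ is an arc-weight function $\omega'$ with $\omega'(uv)=\pm\omega(uv)$ and $\omega'(uv)\omega'(vu)<0$ for every arc $uv$. A cycle of length $t$ is a directed cycle: a subdigraph with distinct vertices $v_1,\dots,v_t$ and arcs $v_1v_2,\dots,v_{t-1}v_t,v_tv_1$. *)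

(* Defs.v *)
From mathcomp Require Import all_boot all_order all_algebra.
From mathcomp Require Import reals.

Set Implicit Arguments.
Unset Strict Implicit.
Unset Printing Implicit Defensive.

Import Order.TTheory GRing.Theory Num.Theory.
Local Open Scope ring_scope.

(* A finite digraph is given by a finType V of vertices and its arc relation
   E : rel V.  An arc-weight function is a total map V -> V -> R of which only
   the values on arcs are meaningful: every definition below reads it on arcs
   only. *)

Definition loopless (V : finType) (E : rel V) : Prop :=
  forall u, ~~ E u u.

Definition symmetric_digraph (V : finType) (E : rel V) : Prop :=
  forall u v, E u v -> E v u.

Definition arc_weight (R : realType) (V : finType) (E : rel V)
    (w : V -> V -> R) : Prop :=
  forall u v, E u v -> w u v != 0.

Definition pwls_digraph (R : realType) (V : finType) (E : rel V)
    (w : V -> V -> R) : Prop :=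
  [/\ arc_weight E w, loopless E, symmetric_digraph E
    & forall u v, E u v -> 0 < w u v].

(* The vertices are ordered by the canonical enumeration of V. *)
Definition weighted_adjacency (R : realType) (V : finType) (E : rel V)
    (w : V -> V -> R) : 'M[R]_#|V| :=
  \matrix_(i, j)
    if E (enum_val i) (enum_val j) then w (enum_val i) (enum_val j) else 0.

Definition skew_signing (R : realType) (V : finType) (E : rel V)
    (w w' : V -> V -> R) : Prop :=
  [/\ arc_weight E w',
      forall u v, E u v -> w' u v = w u v \/ w' u v = - w u v
    & forall u v, E u v -> w' u v * w' v u < 0].

(* ucycle E c: the vertices of c are distinct, consecutive ones are joined by
   arcs, and there is an arc from the last vertex to the first; the length of
   the directed cycle is size c. *)
Definition no_even_cycle_gt2 (V : finType) (E : rel V) : Prop :=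
  ~ exists c : seq V, [/\ ucycle E c, ~~ odd (size c) & (2 < size c)%N].

Definition positively_symmetrizable (R : realType) (n : nat)
    (A : 'M[R]_n) : Prop :=
  exists S Delta : 'M[R]_n,
    [/\ [/\ forall i j, 0 <= S i j, S^T = S & forall i, S i i = 0],
        is_diag_mx Delta /\ (forall i, 0 < Delta i i)
      & A = invmx Delta *m S *m Delta].

(* Main.v *)
(* Write M = 'X - A(D, w') and expand its determinant over permutations.

   (ii) => (i): up to diagonal conjugation A(D, w') is skew-symmetric, so
   reversing an odd cycle of a permutation negates its term.  As the long cycles
   are all odd, reversing one canonically chosen long cycle cancels all terms
   but those of the involutions, which only see the products w'(uv) w'(vu) =
   - w(uv) w(vu).

   (i) => (ii): fix a cycle C of length l > 2 and sum (-1)^|G| det M over the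
   sets G of edges of C whose signs are flipped.  The sum is 0 by (i); a
   permutation survives only if it uses each edge of C in exactly one direction,
   hence runs along C or along its reverse.  This leaves the sum of two
   products, whose ratio is (-1)^l w(C^-1) / w(C), times a nonzero polynomial:
   so l is odd and w(C) = w(C^-1).  Kolmogorov's criterion then symmetrizes
   A(D, w). *)
Require Import Defs.
From mathcomp Require Import all_boot all_order all_algebra all_fingroup.
From mathcomp Require Import reals zify.

Set Implicit Arguments.
Unset Strict Implicit.
Unset Printing Implicit Defensive.

Import Order.TTheory GRing.Theory Num.Theory.
Local Open Scope ring_scope.

(** * Reversing an orbit of a permutation *)

(** On the orbit of [i] the two inverse factors turn [s] into [s^-1]; elsewhere they are trivial. As
    the same factor occurs twice, the parity of [s] is visibly kept. *)
Definition reverse_orbit (T : finType) (s : {perm T}) (i : T) : {perm T} :=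
  (s * (restr_perm (porbit s i) s)^-1 * (restr_perm (porbit s i) s)^-1)%g.

Lemma mem_porbit_perm (T : finType) (s : {perm T}) (i x : T) :
  (s x \in porbit s i) = (x \in porbit s i).
Proof. by rewrite -!eq_porbit_mem (porbit_perm s 1). Qed.

Lemma mem_porbit_permV (T : finType) (s : {perm T}) (i x : T) :
  ((s^-1)%g x \in porbit s i) = (x \in porbit s i).
Proof. by rewrite -(mem_porbit_perm s i (s^-1 x)%g) permKV. Qed.

Lemma astabs_porbit (T : finType) (s : {perm T}) (i : T) :
  s \in 'N(porbit s i | 'P)%g.
Proof. by apply/astabsP => x; rewrite /= /aperm mem_porbit_perm. Qed.

Lemma reverse_orbit_in (T : finType) (s : {perm T}) (i x : T) :
  x \in porbit s i -> reverse_orbit s i x = (s^-1)%g x.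
Proof.
move=> xO; rewrite !permM.
have rsE y : y \in porbit s i -> restr_perm (porbit s i) s y = s y.
  by move=> yO; rewrite restr_permE // astabs_porbit.
rewrite -[s x]rsE // permK.
have xO' : (s^-1)%g x \in porbit s i by rewrite mem_porbit_permV.
by rewrite -{1}[x](permKV s) -rsE // permK.
Qed.

Lemma reverse_orbit_out (T : finType) (s : {perm T}) (i x : T) :
  x \notin porbit s i -> reverse_orbit s i x = s x.
Proof.
move=> xO; rewrite !permM.
have rsV y : y \notin porbit s i -> (restr_perm (porbit s i) s)^-1%g y = y.
  move=> yO; apply: (@perm_inj _ (restr_perm (porbit s i) s)).
  by rewrite permKV (out_perm (restr_perm_on _ _)).
by rewrite !rsV // mem_porbit_perm.
Qed.

Lemma odd_reverse_orbit (T : finType) (s : {perm T}) (i : T) :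
  odd_perm (reverse_orbit s i) = odd_perm s.
Proof. by rewrite !odd_permM !odd_permV -addbA addbb addbF. Qed.

Lemma eq_in_porbit (T : finType) (s t : {perm T}) (i : T) :
  {in porbit s i, t =1 s} -> porbit t i = porbit s i.
Proof.
move=> tE; have iterE k : (t ^+ k)%g i = (s ^+ k)%g i.
  elim: k => [|k IHk]; first by rewrite !expg0.
  by rewrite !expgSr !permM IHk tE // mem_porbit.
by apply/setP => x; apply/porbitP/porbitP => -[k ->]; exists k; rewrite iterE.
Qed.

Lemma porbit_reverse_orbit (T : finType) (s : {perm T}) (i : T) :
  porbit (reverse_orbit s i) i = porbit s i.
Proof.
rewrite -[RHS]porbitV; apply: eq_in_porbit => x; rewrite porbitV.
exact: reverse_orbit_in.
Qed.

Lemma reverse_orbitK (T : finType) (s : {perm T}) (i : T) :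
  reverse_orbit (reverse_orbit s i) i = s.
Proof.
apply/permP => x; case: (boolP (x \in porbit s i)) => xO; last first.
  by rewrite !reverse_orbit_out ?porbit_reverse_orbit.
rewrite reverse_orbit_in ?porbit_reverse_orbit //.
apply: (@perm_inj _ (reverse_orbit s i)).
by rewrite permKV reverse_orbit_in ?permK ?mem_porbit_perm.
Qed.

Lemma reverse_orbit_sqr (T : finType) (s : {perm T}) (i x : T) :
  (reverse_orbit s i (reverse_orbit s i x) == x) = (s (s x) == x).
Proof.
case: (boolP (x \in porbit s i)) => xO.
  rewrite !reverse_orbit_in ?mem_porbit_permV //.
  rewrite -(inj_eq (@perm_inj _ s)) permKV.
  by rewrite -(inj_eq (@perm_inj _ s)) permKV eq_sym.
by rewrite !reverse_orbit_out ?mem_porbit_perm.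
Qed.

Definition reverse_long_orbit (T : finType) (s : {perm T}) : {perm T} :=
  if [pick i | s (s i) != i] is Some i then reverse_orbit s i else s.

Lemma pick_reverse_orbit (T : finType) (s : {perm T}) (i : T) :
  [pick j | reverse_orbit s i (reverse_orbit s i j) != j]
  = [pick j | s (s j) != j].
Proof. by apply: eq_pick => j; rewrite /= reverse_orbit_sqr. Qed.

(** Reversing an orbit does not change which points are moved by the square of [s], so [pick]
    selects the same [i] again. An involution is left as it is. *)
Lemma reverse_long_orbitK (T : finType) : involutive (@reverse_long_orbit T).
Proof.
move=> s; rewrite {2}/reverse_long_orbit.
case Ei: [pick i | s (s i) != i] => [i|]; last first.
  by rewrite /reverse_long_orbit Ei.
by rewrite /reverse_long_orbit pick_reverse_orbit Ei reverse_orbitK.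
Qed.

(** * Invariance of the characteristic polynomial *)

(** Matrix form of a skew-signing. The case [i = j] yields [A i i = - A i i], which later forces a
    zero diagonal. *)
Definition skew_signed (R : zmodType) (n : nat) (A B : 'M[R]_n) : Prop :=
  forall i j, (B i j = A i j /\ B j i = - A j i)
           \/ (B i j = - A i j /\ B j i = A j i).

Lemma char_polyE (R : comNzRingType) (n : nat) (B : 'M[R]_n) :
  char_poly B
  = \sum_(s : 'S_n) (-1) ^+ s * \prod_i ('X *+ (i == s i) - (B i (s i))%:P).
Proof.
apply: eq_bigr => s _; congr (_ * _); apply: eq_bigr => i _.
by rewrite !mxE.
Qed.

(** Each two-element orbit is represented by its smaller point. *)
Lemma prod_involutionE (R : comNzRingType) (n : nat) (s : 'S_n)
    (f : 'I_n -> R) :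
    (forall i, s (s i) = i) ->
  \prod_i f i
  = (\prod_(i | s i == i) f i)
    * (\prod_(i : 'I_n | (i < s i)%N) (f i * f (s i))).
Proof.
move=> sK; rewrite (bigID (fun i => s i == i)) /=; congr (_ * _).
rewrite (bigID (fun i : 'I_n => i < s i)%N) /= big_split /=; congr (_ * _).
  by apply: eq_bigl => i; rewrite neq_ltn andbC; case: ltngtP.
rewrite (reindex_inj (@perm_inj _ s)) /=; apply: eq_bigl => i.
by rewrite sK -val_eqE /=; case: ltngtP.
Qed.

Lemma mem_orbit_porbit (T : finType) (s : {perm T}) (x y : T) :
  (y \in fingraph.orbit s x) = (y \in porbit s x).
Proof.
rewrite -fconnect_orbit; apply/idP/porbitP => [xy|[k ->]].
  by exists (findex s x y); rewrite permX iter_findex.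
by rewrite permX fconnect_iter.
Qed.

(** The orbit, listed along [s], is itself a directed cycle of [e]; the distinct points [i], [s i],
    [s (s i)] make it longer than 2. *)
Lemma odd_porbit (T : finType) (e : rel T) (s : {perm T}) (i : T) :
    no_even_cycle_gt2 e -> s (s i) != i ->
    (forall x, x \in porbit s i -> e x (s x)) ->
  odd #|porbit s i|.
Proof.
move=> noC si es; apply/negPn/negP => ev.
have cardE : #|porbit s i| = size (fingraph.orbit s i).
  rewrite -(card_uniqP (orbit_uniq s i)).
  by apply: eq_card => x; rewrite mem_orbit_porbit.
apply: noC; exists (fingraph.orbit s i); split; last 2 first.
- by rewrite -cardE.
- have sii : s i != i by apply: contraNneq si => si; rewrite !si.
  have /uniq_leq_size : uniq [:: i; s i; s (s i)].
    by rewrite /= !inE (inj_eq perm_inj) !(eq_sym i) negb_or sii si.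
  apply=> x; rewrite mem_orbit_porbit !inE.
  by case/or3P=> /eqP->; rewrite ?mem_porbit_perm porbit_id.
apply/andP; split; last exact: orbit_uniq.
apply: (sub_in_cycle (P := mem (porbit s i)) (e := frel s)).
- by move=> x y xO _ /= /eqP <-; exact: es.
- by apply/allP => x; rewrite mem_orbit_porbit.
- exact/cycle_orbit/perm_inj.
Qed.

(** Multiply the relation between [q] and [B] along the orbit: the factors [q] cancel and an odd
    number of signs remains. If an entry on the orbit vanishes, so does its opposite, and both sides
    are 0. *)
Lemma prod_reverse_orbit (R : idomainType) (n : nat) (B : 'M[R]_n)
    (q : 'I_n -> R) (s : 'S_n) (i : 'I_n) :
    no_even_cycle_gt2 (fun x y => B x y != 0) ->
    (forall x, q x != 0) -> (forall x y, q x * B x y = - (q y * B y x)) ->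
    s (s i) != i ->
  \prod_(x in porbit s i) B x ((s^-1)%g x)
  = - \prod_(x in porbit s i) B x (s x).
Proof.
move=> noC q0 qB si.
have reindexO (F : 'I_n -> R) :
    \prod_(x in porbit s i) F x = \prod_(x in porbit s i) F (s x).
  rewrite (reindex_inj (@perm_inj _ s)); apply: eq_bigl => x.
  by rewrite mem_porbit_perm.
rewrite reindexO; under eq_bigr => x _ do rewrite permK.
case: (boolP [exists x in porbit s i, B x (s x) == 0]) => [|/exists_inPn Bn0].
  case/exists_inP => x xO /eqP Bx.
  have Bx' : B (s x) x = 0.
    have := qB (s x) x; rewrite Bx mulr0 oppr0 => /eqP.
    by rewrite mulf_eq0 (negPf (q0 _)) => /eqP.
  by rewrite (bigD1 x) // [X in - X](bigD1 x) //= Bx Bx' !mul0r oppr0.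
have oddO : odd #|porbit s i| := odd_porbit noC si Bn0.
have Q0 : \prod_(x in porbit s i) q x != 0 by apply/prodf_neq0.
(* Only the left product of [q] is shifted by [s], so that [q (s x)] meets [B (s x) x]. *)
apply: (mulfI Q0); rewrite {1}reindexO mulrN -!big_split /=.
under eq_bigr => x _ do rewrite qB.
by rewrite prodrN -signr_odd oddO expr1 mulN1r.
Qed.

Lemma porbit_moved (T : finType) (s : {perm T}) (i x : T) :
  s (s i) != i -> x \in porbit s i -> s x != x.
Proof.
move=> si xO; apply: contraNneq si => sx.
move: xO; rewrite porbit_sym => /porbitP[k].
have -> : (s ^+ k)%g x = x.
  by elim: k => [|k IHk]; rewrite ?expg0 ?perm1 // expgSr permM IHk.
by move->; rewrite !sx.
Qed.

(** [reverse_long_orbit] matches the permutations that are not involutions in pairs with equal signs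
    and opposite products. Their sum is its own negative, hence 0 over a [numDomainType]. *)
Lemma char_poly_involutions (R : numDomainType) (n : nat) (B : 'M[R]_n)
    (q : 'I_n -> R) :
    no_even_cycle_gt2 (fun x y => B x y != 0) ->
    (forall x, q x != 0) -> (forall x y, q x * B x y = - (q y * B y x)) ->
  char_poly B
  = \sum_(s : 'S_n | [forall i, s (s i) == i])
      (-1) ^+ s * \prod_i ('X *+ (i == s i) - (B i (s i))%:P).
Proof.
move=> noC q0 qB; rewrite char_polyE.
rewrite (bigID (fun s : 'S_n => [forall i, s (s i) == i])) /=.
rewrite [X in _ + X](_ : _ = 0) ?addr0 //.
set S := (X in X = _).
suff SN : S = - S.
  apply/polyP => k; rewrite coef0; apply/eqP.
  suff : S`_k *+ 2 == 0 by rewrite mulrn_eq0.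
  by rewrite mulr2n {1}SN coefN addNr.
rewrite /S -sumrN (reindex_inj (inv_inj (@reverse_long_orbitK _))) /=.
apply: eq_big => [s|s]; rewrite /reverse_long_orbit; case: pickP => [i si|inv].
- by congr (~~ _); apply: eq_forallb => x; rewrite reverse_orbit_sqr.
- by [].
- move=> _; rewrite odd_reverse_orbit -mulrN; congr (_ * _).
  rewrite (bigID (mem (porbit s i))) [in RHS](bigID (mem (porbit s i))) /=.
  rewrite -mulNr; congr (_ * _); last first.
    by apply: eq_bigr => x xO; rewrite reverse_orbit_out.
  (* A long orbit has no fixed point, so ['X] does not occur in its factors. *)
  have -> : \prod_(x in porbit s i) ('X *+ (x == s x) - (B x (s x))%:P)
          = \prod_(x in porbit s i) (- B x (s x))%:P.
    apply: eq_bigr => x xO.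
    by rewrite eq_sym (negPf (porbit_moved si xO)) sub0r polyCN.
  rewrite -rmorph_prod prodrN -polyCN -mulrN -(prod_reverse_orbit noC q0 qB si).
  rewrite -prodrN rmorph_prod; apply: eq_bigr => x xO /=.
  rewrite reverse_orbit_in // -{1}(permKV s x) (negPf (porbit_moved si _)).
    by rewrite sub0r polyCN.
  by rewrite mem_porbit_permV.
- by case/negP; apply/forallP => x; rewrite -[_ == _]negbK inv.
Qed.

(** For an involution [s] the off-diagonal entries come in products [B i (s i) * B (s i) i], which
    equal [- (A i (s i) * A (s i) i)] for every choice of signs. *)
Lemma char_poly_skew_signed (R : numDomainType) (n : nat) (A B1 B2 : 'M[R]_n)
    (q : 'I_n -> R) :
    no_even_cycle_gt2 (fun x y => A x y != 0) ->
    (forall x, q x != 0) -> (forall x y, q x * A x y = q y * A y x) ->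
    skew_signed A B1 -> skew_signed A B2 -> char_poly B1 = char_poly B2.
Proof.
move=> noC q0 qA.
have key B : skew_signed A B ->
    (forall x y, (B x y != 0) = (A x y != 0))
    /\ (forall x y, q x * B x y = - (q y * B y x)).
  move=> AB; split=> x y; case: (AB x y) => -[Bxy Byx];
    by rewrite Bxy ?Byx ?oppr_eq0 ?mulrN ?opprK // qA.
have expand B : skew_signed A B -> char_poly B
  = \sum_(s : 'S_n | [forall i, s (s i) == i])
      (-1) ^+ s * ((\prod_(i | s i == i) 'X)
                 * \prod_(i : 'I_n | (i < s i)%N) - (A i (s i) * A (s i) i)%:P).
  move=> AB; have [B0 qB] := key B AB.
  have A0 x : A x x = 0.
    have ABx : B x x = A x x /\ B x x = - A x x by case: (AB x x) => -[].
    apply/eqP; suff : A x x *+ 2 == 0 by rewrite mulrn_eq0.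
    by rewrite mulr2n -{1}ABx.1 ABx.2 addNr.
  have Bxx x : B x x = 0 by apply/eqP/negPn; rewrite B0 A0 eqxx.
  rewrite (char_poly_involutions _ q0 qB).
    apply: eq_bigr => s /forallP sK; congr (_ * _).
    rewrite (@prod_involutionE _ _ s) => [|i]; last exact/eqP.
    congr (_ * _); apply: eq_bigr => i.
      by move/eqP=> ->; rewrite eqxx Bxx subr0.
    move=> lti; rewrite (eqP (sK i)) (eq_sym (s i)).
    have /negPf-> : i != s i by rewrite -val_eqE /= neq_ltn lti.
    rewrite !sub0r mulrNN -polyCM -polyCN; congr (_%:P).
    by case: (AB i (s i)) => -[-> ->]; rewrite ?mulrN ?mulNr.
  move=> [c [cC co c2]]; apply: noC; exists c; split=> //.
  case/andP: cC => cC cu; rewrite /ucycle cu andbT.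
  by rewrite -(eq_cycle B0).
by move=> h1 h2; rewrite !expand.
Qed.

(** * Flipping the signs along a cycle *)

(** A point [x] stands for the edge {x, p x}. The exclusive or makes [flipped] symmetric in [i] and
    [j], so that skewness survives a flip, and false for [i = j]. *)
Definition flipped (n : nat) (p : 'S_n) (G : {set 'I_n}) (i j : 'I_n) : bool :=
  ((i \in G) && (j == p i)) (+) ((j \in G) && (i == p j)).

Definition flip (R : pzRingType) (n : nat) (p : 'S_n) (G : {set 'I_n})
    (B : 'M[R]_n) : 'M[R]_n :=
  \matrix_(i, j) ((-1) ^+ flipped p G i j * B i j).

Lemma skew_signed_flip (R : pzRingType) (n : nat) (p : 'S_n) (G : {set 'I_n})
    (A B : 'M[R]_n) :
  skew_signed A B -> skew_signed A (flip p G B).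
Proof.
move=> AB i j; rewrite !mxE [flipped p G j i]addbC -/(flipped p G i j).
case: (AB i j) => -[-> ->]; case: (flipped p G i j);
  rewrite ?expr1 ?expr0 ?mulN1r ?mul1r ?opprK; by [left | right].
Qed.

(** Parity of the use of the edge {x, p x} by [s], with one count per direction: the exponent of the
    sign that the term of [s] gains when this edge is flipped. *)
Definition odd_use (n : nat) (p s : 'S_n) (x : 'I_n) : bool :=
  (s x == p x) (+) (s (p x) == x).

(** Double counting of the incidences between the arcs from [i] to [s i] and the edges in [G].
    Backward uses are matched by [x = s i]. *)
Lemma prod_flipped (R : comNzRingType) (n : nat) (p s : 'S_n) (G : {set 'I_n}) :
  \prod_i (-1) ^+ flipped p G i (s i)
  = \prod_(x in G) (-1) ^+ odd_use p s x :> R.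
Proof.
under eq_bigr => i _ do rewrite signr_addb.
under [RHS]eq_bigr => x _ do rewrite signr_addb.
rewrite !big_split /=; congr (_ * _).
  by rewrite [RHS]big_mkcond; apply: eq_bigr => i _; case: (i \in G).
rewrite [RHS]big_mkcond [RHS](reindex_inj (@perm_inj _ s)) /=.
apply: eq_bigr => i _; rewrite (inj_eq perm_inj) (eq_sym i).
by case: (s i \in G).
Qed.

Lemma char_poly_flip (R : comNzRingType) (n : nat) (p : 'S_n) (G : {set 'I_n})
    (B : 'M[R]_n) :
  char_poly (flip p G B)
  = \sum_(s : 'S_n) (\prod_(x in G) (-1) ^+ odd_use p s x)
      * ((-1) ^+ s * \prod_i ('X *+ (i == s i) - (B i (s i))%:P)).
Proof.
rewrite char_polyE; apply: eq_bigr => s _.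
rewrite mulrCA; congr (_ * _); rewrite -prod_flipped -big_split /=.
apply: eq_bigr => i _; rewrite mxE.
(* A diagonal entry is never flipped, so the factor containing ['X] keeps its sign. *)
case: (eqVneq i (s i)) => [<-|_]; first by rewrite /flipped addbb expr0 !mul1r.
by rewrite !sub0r mulrN polyCM; congr (- (_ * _)); rewrite rmorph_sign.
Qed.

(** Expand the product of the factors [(-1) ^+ b x + 1], each of them 2 or 0. This is the
    orthogonality of the characters of the group of subsets. *)
Lemma sum_sign_subsets (R : comPzRingType) (T : finType) (b : pred T) :
  \sum_(G : {set T}) \prod_(x in G) (-1) ^+ b x
  = (if [forall x, ~~ b x] then 2 ^+ #|T| else 0) :> R.
Proof.
transitivity (\prod_x ((-1) ^+ b x + 1 : R)).
  by rewrite bigA_distr; apply: eq_bigr => G _; rewrite big_mkcond.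
case: ifP => [/forallP b0|/forallPn[x]].
  under eq_bigr => x _ do rewrite (negPf (b0 x)) expr0.
  by rewrite prodr_const cardT.
by rewrite negbK => bx; rewrite (bigD1 x) //= bx expr1 addNr mul0r.
Qed.

(* Extracting, in the Fourier expansion over the signs of the edges {x, p x}
   with x in O, the coefficient of the character that flips at each edge *)
Lemma sum_char_poly_flip (R : comNzRingType) (n : nat) (p : 'S_n)
    (O : {set 'I_n}) (B : 'M[R]_n) :
  \sum_(G : {set 'I_n})
     (\prod_(x in G) (-1) ^+ (x \in O)) * char_poly (flip p (G :&: O) B)
  = 2 ^+ n * \sum_(s : 'S_n | [forall x in O, odd_use p s x])
      (-1) ^+ s * \prod_i ('X *+ (i == s i) - (B i (s i))%:P).
Proof.
under eq_bigr => G _ do rewrite char_poly_flip big_distrr /=.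
rewrite exchange_big big_distrr /= [RHS]big_mkcond; apply: eq_bigr => s _ /=.
(* For [x] in [G], the weight and the flip at [x] together contribute [(-1) ^+ b x]; points outside
   [O] contribute a trivial sign. *)
pose b x := (x \in O) && ~~ odd_use p s x.
transitivity ((\sum_(G : {set 'I_n}) \prod_(x in G) (-1) ^+ b x)
    * ((-1) ^+ s * \prod_i ('X *+ (i == s i) - (B i (s i))%:P)) : {poly R}).
  rewrite big_distrl; apply: eq_bigr => G _ /=; rewrite mulrA; congr (_ * _).
  rewrite [X in _ * X]big_mkcond [X in X * _]big_mkcond [RHS]big_mkcond.
  rewrite -big_split; apply: eq_bigr => x _ /=; rewrite inE /b.
  case: (x \in G); case: (x \in O); case: (odd_use p s x) => /=;
    by rewrite ?expr0 ?expr1 ?mulrNN ?mulr1 ?mul1r.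
rewrite sum_sign_subsets card_ord.
rewrite (_ : [forall x, ~~ b x] = [forall x in O, odd_use p s x]).
  by case: ifP => // _; rewrite mul0r.
by apply: eq_forallb => x; rewrite negb_and negbK implybE.
Qed.

(** If [s] agrees with [p] at [x], injectivity forbids it to send [p (p x)] back to [p x], so the
    next edge is used forward as well, and so on around the orbit. If no edge is used forward, all
    are used backward. *)
Lemma odd_use_porbit (n : nat) (p s : 'S_n) (i : 'I_n) :
    (forall x, x \in porbit p i -> p (p x) != x) ->
  [forall x in porbit p i, odd_use p s x]
  = [forall x in porbit p i, s x == p x]
    || [forall x in porbit p i, s x == (p^-1)%g x].
Proof.
move=> pp; apply/forall_inP/orP => [ou|[/forall_inP sp|/forall_inP sp] x xO].
- case: (boolP [exists x in porbit p i, s x == p x]) => [/exists_inP[x xO sx]|].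
    left; apply/forall_inP => y.
    have -> : porbit p i = porbit p x.
      by apply/eqP; rewrite eq_porbit_mem porbit_sym.
    case/porbitP=> k ->; elim: k => [|k IHk]; first by rewrite expg0 perm1.
    have zO : (p ^+ k)%g x \in porbit p i.
      by rewrite -eq_porbit_mem porbit_perm eq_porbit_mem.
    rewrite expgSr permM; move: (ou (p ((p ^+ k)%g x))).
    rewrite mem_porbit_perm => /(_ zO); rewrite /odd_use.
    rewrite -[X in s (p (p _)) == X](eqP IHk) (inj_eq perm_inj).
    by rewrite (negPf (pp _ zO)) addbF.
  move=> /exists_inPn sn; right; apply/forall_inP => y yO.
  have zO : (p^-1)%g y \in porbit p i by rewrite mem_porbit_permV.
  by move: (ou _ zO); rewrite /odd_use (negPf (sn _ zO)) permKV.
- rewrite /odd_use sp // (eqP (sp _ _)) ?mem_porbit_perm //.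
  by rewrite (negPf (pp _ xO)).
- rewrite /odd_use [s (p x) == x](_ : _ = true); last first.
    by rewrite (eqP (sp _ _)) ?mem_porbit_perm // permK eqxx.
  rewrite addbT (eqP (sp _ xO)) -(inj_eq (@perm_inj _ p)) permKV eq_sym.
  exact: pp.
Qed.

(** The permutations in question are [r * t] with [t] fixing [O] pointwise. The last factor does not
    depend on [r], so a cycle and its reverse share it. *)
Lemma sum_perm_extending (R : comNzRingType) (n : nat) (O : {set 'I_n})
    (r : 'S_n) (M : 'I_n -> 'I_n -> R) :
    perm_on O r ->
  \sum_(s : 'S_n | [forall x in O, s x == r x]) (-1) ^+ s * \prod_i M i (s i)
  = (-1) ^+ r * (\prod_(x in O) M x (r x))
    * \sum_(s : 'S_n | [forall x in O, s x == x])
        (-1) ^+ s * \prod_(i in ~: O) M i (s i).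
Proof.
move=> rO; rewrite (reindex_inj (mulgI r)) big_distrr /=.
have rxO x : (r x \in O) = (x \in O) by rewrite (perm_closed _ rO).
apply: eq_big => s.
  apply/forall_inP/forall_inP => sE x xO.
    rewrite -[X in s X](permKV r); have := sE ((r^-1)%g x).
    by rewrite -rxO permKV permM permKV => /(_ xO).
  by rewrite permM sE ?rxO.
move=> /forall_inP sE; rewrite odd_permM signr_addb -!mulrA; congr (_ * _).
rewrite mulrCA; congr (_ * _); rewrite (bigID (mem O)) /=; congr (_ * _).
  apply: eq_bigr => x xO; rewrite permM; congr (M _ _); apply/eqP.
  by have := sE x xO; rewrite permM.
apply: eq_big => x; first by rewrite inE.
by move=> xO; rewrite permM (out_perm rO).
Qed.

(* Up to the factor 'X^#|O|, this sum is the characteristic polynomial of the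
   matrix with the rows in O zeroed out *)
Lemma sum_perm_fixing_neq0 (R : idomainType) (n : nat) (O : {set 'I_n})
    (B : 'M[R]_n) :
  \sum_(s : 'S_n | [forall x in O, s x == x])
     (-1) ^+ s * \prod_(i in ~: O) ('X *+ (i == s i) - (B i (s i))%:P) != 0.
Proof.
pose B' := \matrix_(i, j) (if i \in O then 0 else B i j) : 'M[R]_n.
suff E : char_poly B' = 'X ^+ #|O| *
  \sum_(s : 'S_n | [forall x in O, s x == x])
     (-1) ^+ s * \prod_(i in ~: O) ('X *+ (i == s i) - (B i (s i))%:P).
  have := monic_neq0 (char_poly_monic B').
  by rewrite E mulf_eq0 negb_or => /andP[].
rewrite char_polyE (bigID (fun s : 'S_n => [forall x in O, s x == x])) /=.
rewrite [X in _ + X]big1 ?addr0 => [|s /forall_inPn[x xO sx]].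
  rewrite big_distrr; apply: eq_bigr => s /forall_inP sO /=.
  rewrite mulrCA; congr (_ * _); rewrite (bigID (mem O)) /=; congr (_ * _).
    rewrite -prodr_const; apply: eq_bigr => x xO.
    by rewrite (eqP (sO x xO)) eqxx mxE xO subr0.
  apply: eq_big => x; first by rewrite inE.
  by move=> /negPf xO; rewrite mxE xO.
by rewrite (bigD1 x) //= mxE xO eq_sym (negPf sx) subrr mul0r mulr0.
Qed.

(** A concrete skew-signing on which the flips can act; the order of the indices decides the
    signs. *)
Definition lower_signing (R : zmodType) (n : nat) (A : 'M[R]_n) : 'M[R]_n :=
  \matrix_(i, j) (if (i < j)%N then A i j else - A i j).

Lemma skew_signed_lower_signing (R : zmodType) (n : nat) (A : 'M[R]_n) :
  (forall i, A i i = 0) -> skew_signed A (lower_signing A).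
Proof.
move=> A0 i j; rewrite !mxE; case: (ltngtP i j) => [lij|lji|/val_inj->].
- by left.
- by right.
- by rewrite A0 oppr0; left.
Qed.

(** The condition [perm_on] says that [p] is a single cycle. The surviving permutations extend [p]
    or its inverse, which have the same parity and a common nonzero cofactor. *)
Lemma sum_orientations_eq0 (R : numDomainType) (n : nat) (A B : 'M[R]_n)
    (p : 'S_n) (i : 'I_n) :
    (forall B1 B2, skew_signed A B1 -> skew_signed A B2 ->
       char_poly B1 = char_poly B2) ->
    skew_signed A B -> perm_on (porbit p i) p -> p (p i) != i ->
  \prod_(x in porbit p i) (- B x (p x))
  + \prod_(x in porbit p i) (- B (p x) x) = 0.
Proof.
move=> same AB pO pi.
have pp x : x \in porbit p i -> p (p x) != x.
  move=> xO; apply: contraNneq pi => px.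
  move: xO; rewrite porbit_sym => /porbitP[k ->].
  by rewrite permX -!iterS !iterSr px.
have p1 x : x \in porbit p i -> p x != x := porbit_moved pi.
have := sum_char_poly_flip p (porbit p i) B.
rewrite (eq_bigr (fun G : {set 'I_n} =>
  (\prod_(x in G) (-1) ^+ (x \in porbit p i)) * char_poly B))
  => [|G _]; last first.
  by rewrite (same _ B (skew_signed_flip p (G :&: porbit p i) AB) AB).
(* The character is nontrivial, as [i] lies in its own orbit, so its values sum to 0. *)
rewrite -big_distrl /= sum_sign_subsets ifF; last first.
  by apply/negP => /forallP/(_ i); rewrite porbit_id.
rewrite mul0r => /esym/eqP; rewrite mulf_eq0 expf_eq0.
have /negPf-> : (2 : {poly R}) != 0.
  by rewrite -(rmorph_nat polyC) polyC_eq0 pnatr_eq0.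
rewrite andbF orFb => /eqP.
rewrite (bigID (fun s : 'S_n => [forall x in porbit p i, s x == p x])) /=.
rewrite (eq_bigl (fun s : 'S_n => [forall x in porbit p i, s x == p x]))
  => [|s]; last first.
  by rewrite odd_use_porbit // orbK.
rewrite [X in _ + X](eq_bigl
  (fun s : 'S_n => [forall x in porbit p i, s x == (p^-1)%g x]))
  => [|s]; last first.
  (* The two directions exclude each other because [p (p i) != i]. *)
  rewrite odd_use_porbit // andb_orl andbN /= andb_idr // => /forall_inP sV.
  apply/forall_inPn; exists i; first exact: porbit_id.
  apply: contraNneq pi => <-; rewrite (eqP (sV i _)) ?porbit_id //.
  by rewrite permKV.
rewrite (sum_perm_extending (fun x y => 'X *+ (x == y) - (B x y)%:P) pO).
rewrite (sum_perm_extending (fun x y => 'X *+ (x == y) - (B x y)%:P)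
  (_ : perm_on (porbit p i) p^-1%g)); last by rewrite perm_onV.
rewrite odd_permV -mulrDl -mulrDr => /eqP.
rewrite mulf_eq0 (negPf (sum_perm_fixing_neq0 _ _)) orbF.
rewrite mulf_eq0 signr_eq0 orFb => /eqP sum0.
apply/eqP; rewrite -(@polyC_eq0 R) polyCD !rmorph_prod -{}[X in _ == X]sum0.
apply/eqP.
congr (_ + _).
  by apply: eq_bigr => x xO /=; rewrite eq_sym (negPf (p1 x xO)) sub0r polyCN.
rewrite [RHS](reindex_inj (@perm_inj _ p)) /=.
apply: eq_big => x; first by rewrite mem_porbit_perm.
by move=> xO; rewrite permK (negPf (p1 x xO)) sub0r polyCN.
Qed.

(** Opposite entries of [lower_signing] carry opposite signs, so both products share a sign factor.
    Without it, a positive product plus [(-1)] to the length times another positive product is 0: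
    the length is odd and the products agree. *)
Lemma odd_reversible_orbit (R : numDomainType) (n : nat) (A : 'M[R]_n)
    (p : 'S_n) (i : 'I_n) :
    (forall B1 B2, skew_signed A B1 -> skew_signed A B2 ->
       char_poly B1 = char_poly B2) ->
    (forall x, A x x = 0) -> perm_on (porbit p i) p -> p (p i) != i ->
    (forall x, x \in porbit p i -> 0 < A x (p x) /\ 0 < A (p x) x) ->
  odd #|porbit p i|
  /\ \prod_(x in porbit p i) A x (p x) = \prod_(x in porbit p i) A (p x) x.
Proof.
move=> same A0 pO pi Apos.
have := sum_orientations_eq0 same (skew_signed_lower_signing A0) pO pi.
pose b (x : 'I_n) := (x < p x)%N.
rewrite (eq_bigr (fun x => (-1) ^+ b x * A x (p x))) => [|x xO]; last first.
  by rewrite mxE -/(b x); case: (b x); rewrite ?mulN1r ?mul1r ?opprK.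
rewrite [X in _ + X](eq_bigr (fun x => (-1) ^+ b x * - A (p x) x))
  => [|x xO]; last first.
  rewrite mxE /b; have := porbit_moved pi xO; rewrite -val_eqE /=.
  by case: ltngtP => // _ _; rewrite ?mulN1r ?mul1r ?opprK.
rewrite !big_split /= -mulrDr => /eqP; rewrite mulf_eq0 => /orP[|/eqP].
  by move/negPn => /negP[]; apply/prodf_neq0 => x _; rewrite signr_eq0.
have Apos1 : 0 < \prod_(x in porbit p i) A x (p x).
  by apply: prodr_gt0 => x /Apos[].
have Apos2 : 0 < \prod_(x in porbit p i) A (p x) x.
  by apply: prodr_gt0 => x /Apos[].
rewrite prodrN -signr_odd; case: (odd _) => /=.
  by rewrite mulN1r => /eqP; rewrite subr_eq0 => /eqP.
by rewrite mul1r => sum0; have := addr_gt0 Apos1 Apos2; rewrite sum0 ltxx.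
Qed.

(** * Potentials *)

(** [next c] is a permutation that fixes every point off [c] and has [c] as an orbit, so the result
    on orbits applies. *)
Lemma reversible_ucycle (R : numDomainType) (n : nat) (A : 'M[R]_n)
    (c : seq 'I_n) :
    (forall B1 B2, skew_signed A B1 -> skew_signed A B2 ->
       char_poly B1 = char_poly B2) ->
    (forall x, A x x = 0) -> (forall x y, 0 <= A x y) ->
    (forall x y, A x y != 0 -> A y x != 0) ->
    ucycle (fun x y => A x y != 0) c -> (2 < size c)%N ->
  odd (size c)
  /\ \prod_(x <- c) A x (next c x) = \prod_(x <- c) A (next c x) x.
Proof.
move=> same A0 Age Asym /andP[cC cU] c2.
pose p := perm (can_inj (prev_next cU)).
have pE x : p x = next c x by rewrite permE.
case Ec: c c2 => [|x [|y [|z t]]] // _; rewrite -Ec.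
have xc : x \in c by rewrite Ec inE eqxx.
have orbE u : (u \in porbit p x) = (u \in c).
  rewrite -mem_orbit_porbit -fconnect_orbit.
  rewrite (eq_fconnect (f' := next c)) => [|v]; last exact: pE.
  by rewrite (fconnect_cycle (cycle_next cU)).
have pO : perm_on (porbit p x) p.
  apply/subsetP => u; rewrite inE pE orbE; apply: contraR => uc.
  by rewrite next_nth (negPf uc).
have px : p (p x) != x.
  move: (cU); rewrite !pE Ec /= eqxx !inE !negb_or -!andbA.
  case/and4P=> xy xz _ _; rewrite (eq_sym y) (negPf xy) /= ?eqxx.
  by rewrite eq_sym.
have Apos u : u \in porbit p x -> 0 < A u (p u) /\ 0 < A (p u) u.
  rewrite orbE pE => uc; have Au := next_cycle cC uc.
  by rewrite !lt_def !Age Au Asym.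
have [oddc prodc] := odd_reversible_orbit same A0 pO px Apos.
split; first by rewrite -(card_uniqP cU) -(eq_card orbE).
rewrite !big_uniq //; move: prodc; under eq_bigl => u do rewrite orbE.
under eq_bigr => u _ do rewrite pE; move=> ->.
by apply: eq_big => u; rewrite ?orbE ?pE.
Qed.

Fixpoint walk_weight (R : pzRingType) (T : Type) (r : T -> T -> R) (x : T)
    (p : seq T) : R :=
  if p is y :: p' then r x y * walk_weight r y p' else 1.

Lemma walk_weight_cat (R : pzRingType) (T : Type) (r : T -> T -> R) (x : T)
    (p1 p2 : seq T) :
  walk_weight r x (p1 ++ p2)
  = walk_weight r x p1 * walk_weight r (last x p1) p2.
Proof. by elim: p1 x => [|y p1 IHp] x /=; rewrite ?mul1r // IHp mulrA. Qed.

Lemma walk_weight_gt0 (R : numDomainType) (T : Type) (e : rel T)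
    (r : T -> T -> R) (x : T) (p : seq T) :
  (forall x y, e x y -> 0 < r x y) -> path e x p -> 0 < walk_weight r x p.
Proof.
move=> rpos; elim: p x => [|y p IHp] x //= /andP[xy py].
by rewrite mulr_gt0 ?rpos ?IHp.
Qed.

Lemma prod_next_walk (R : comPzRingType) (T : eqType) (r : T -> T -> R) (x : T)
    (p : seq T) :
  uniq (x :: p) ->
  \prod_(z <- x :: p) r z (next (x :: p) z) = walk_weight r x (rcons p x).
Proof.
(* In [next_at] the closing vertex [x] stays fixed while the head [y] advances, as the induction
   requires. *)
suff gen y : uniq (y :: p) ->
    \prod_(z <- y :: p) r z (next_at z x y p) = walk_weight r y (rcons p x).
  exact: gen.
elim: p y => [|y' p IHp] y; first by rewrite big_seq1 /= eqxx mulr1.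
move=> /=/andP[yp up]; rewrite big_cons /= eqxx -IHp //; congr (_ * _).
rewrite !big_seq; apply: eq_bigr => z zp; case: eqVneq => // zy.
by rewrite -zy zp in yp.
Qed.

Lemma not_uniq_split (T : eqType) (p : seq T) :
  ~~ uniq p -> exists y p1 p2 p3, p = p1 ++ y :: p2 ++ y :: p3.
Proof.
elim: p => [|a p IHp] //=; rewrite negb_and negbK => /orP[|/IHp].
  by case/splitPr=> p1 p2; exists a, [::], p1, p2.
by case=> [y [p1 [p2 [p3 ->]]]]; exists y, (a :: p1), p2, p3.
Qed.

(* A closed walk that is not a cycle splits at a repeated vertex into two
   shorter closed walks *)
Lemma closed_walk_weight (R : comPzRingType) (T : eqType) (e : rel T)
    (r : T -> T -> R) (x : T) (p : seq T) :
    (forall c, ucycle e c -> \prod_(z <- c) r z (next c z) = 1) ->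
  path e x p -> last x p = x -> walk_weight r x p = 1.
Proof.
move=> rcyc; have [m] := ubnP (size p); elim: m x p => // m IHm x p.
have [up|/not_uniq_split[y [p1 [p2 [p3 ->]]]]] := boolP (uniq p).
  case/lastP: p up => [|p z] //; rewrite last_rcons => up _ pp zx.
  rewrite {z}zx in up pp *; rewrite rcons_uniq -/(uniq (x :: p)) in up.
  by rewrite -prod_next_walk // rcyc // /ucycle /= pp.
rewrite size_cat /= size_cat /= => szp.
rewrite cat_path last_cat /= cat_path last_cat /=.
case/and5P=> p1P p1y p2P p2y p3P p3x.
have w1 : walk_weight r x (p1 ++ y :: p3) = 1.
  apply: IHm; rewrite ?size_cat ?cat_path ?last_cat //= ?p1P ?p1y //.
  by lia.
have w2 : walk_weight r y (p2 ++ [:: y]) = 1.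
  apply: IHm; rewrite ?size_cat ?cat_path ?last_cat //= ?p2P ?p2y //.
  by lia.
rewrite -w1 !walk_weight_cat /= walk_weight_cat /=.
move: w2; rewrite walk_weight_cat /= mulr1 => w2.
by rewrite [walk_weight r y p2 * _]mulrA w2 mul1r.
Qed.

(* Kolmogorov's criterion for the reversibility of a Markov chain *)
Lemma potential_exists (R : numFieldType) (T : finType) (e : rel T)
    (r : T -> T -> R) :
    symmetric e -> (forall x y, e x y -> 0 < r x y) ->
    (forall c, ucycle e c -> \prod_(z <- c) r z (next c z) = 1) ->
  exists q : T -> R,
    (forall x, 0 < q x) /\ (forall x y, e x y -> q y = q x * r x y).
Proof.
move=> esym rpos rcyc.
have csym : connect_sym e by apply: sym_connect_sym.
have [f fP] : exists f : T -> seq T, forall x,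
    path e (fingraph.root e x) (f x) /\ last (fingraph.root e x) (f x) = x.
  apply: (@fin_all_exists _ _ (fun x p =>
    path e (fingraph.root e x) p /\ last (fingraph.root e x) p = x)) => x.
  have /connectP[p pP px] : connect e (fingraph.root e x) x.
    by rewrite csym connect_root.
  by exists p.
(* The potential at [x] is the weight of a chosen walk to [x] from the root of its component. *)
exists (fun x => walk_weight r (fingraph.root e x) (f x)); split=> [x|x y xy].
  by apply: walk_weight_gt0 rpos _; case: (fP x).
have [xP xl] := fP x; have [yP yl] := fP y.
have rE : fingraph.root e x = fingraph.root e y.
  by apply/eqP; rewrite root_connect // connect1.
rewrite {}rE in xP xl *.
(* Closed up by one walk [p] back to the root, both sides become weights of closed walks, that is
   1. *)
have /connectP[p pP pl] : connect e y (fingraph.root e y) := connect_root e y.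
have pn0 : walk_weight r y p != 0 by rewrite gt_eqF // (walk_weight_gt0 rpos).
apply: (mulIf pn0).
have -> : walk_weight r (fingraph.root e y) (f y) * walk_weight r y p
        = walk_weight r (fingraph.root e y) (f y ++ p).
  by rewrite walk_weight_cat yl.
rewrite (closed_walk_weight rcyc) ?cat_path ?last_cat ?yP ?yl //.
have -> : walk_weight r (fingraph.root e y) (f x) * r x y * walk_weight r y p
        = walk_weight r (fingraph.root e y) (f x ++ y :: p).
  by rewrite walk_weight_cat xl /= mulrA.
by rewrite (closed_walk_weight rcyc) ?cat_path ?last_cat ?xP ?xl //= ?xy.
Qed.

(** * From matrices to digraphs *)

Lemma diag_mx_unit (R : fieldType) (n : nat) (d : 'rV[R]_n) :
  (forall i, d 0 i != 0) -> diag_mx d \in unitmx.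
Proof. by move=> d0; rewrite unitmxE det_diag unitfE; apply/prodf_neq0. Qed.

(** From [D *m A = S *m D], the number [D i i * D i i * A i j] is symmetric in [i] and [j], so [q]
    is the squared diagonal of [D]. Conversely, [D] is the square root of [q]. *)
Lemma positively_symmetrizableP (R : realType) (n : nat) (A : 'M[R]_n) :
    (forall i j, 0 <= A i j) -> (forall i, A i i = 0) ->
  positively_symmetrizable A <->
  exists q : 'I_n -> R,
    (forall i, 0 < q i) /\ (forall i j, q i * A i j = q j * A j i).
Proof.
move=> Age A0; split.
  case=> S [D [[_ /matrixP ST _] [/is_diag_mxP Dd Dpos] AE]].
  have DE : D = diag_mx (\row_i D i i).
    apply/matrixP => i j; rewrite !mxE.
    by case: eqVneq => [->|/Dd->].
  have DAE : D *m A = S *m D.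
    rewrite AE !mulmxA mulmxV ?mul1mx // DE diag_mx_unit // => i.
    by rewrite mxE gt_eqF.
  have entry i j : D i i * A i j = S i j * D j j.
    move/matrixP: DAE => /(_ i j).
    by rewrite DE mul_diag_mx mul_mx_diag !mxE !eqxx.
  exists (fun i => D i i * D i i); split=> [i|i j]; first by rewrite mulr_gt0.
  have SE : S j i = S i j by rewrite -ST mxE.
  by rewrite -!mulrA !entry SE mulrCA [RHS]mulrCA [D i i * _]mulrC.
case=> q [qpos qA].
pose d i := Num.sqrt (q i).
have d0 i : 0 < d i by rewrite sqrtr_gt0.
have dn0 i : d i != 0 by rewrite gt_eqF.
have dd i : d i * d i = q i by rewrite -expr2 sqr_sqrtr // ltW.
exists (\matrix_(i, j) (d i * A i j / d j)), (diag_mx (\row_i d i)).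
split; first split.
- by move=> i j; rewrite mxE divr_ge0 ?mulr_ge0 // ltW.
- apply/matrixP => i j; rewrite !mxE; apply/eqP.
  by rewrite eqr_div // mulrAC dd [eqbRHS]mulrAC dd qA.
- by move=> i; rewrite mxE A0 mulr0 mul0r.
- split=> [|i]; first exact: diag_mx_is_diag.
  by rewrite !mxE eqxx mulr1n.
rewrite -mulmxA mul_mx_diag.
have -> : \matrix_(i, j) ((\matrix_(i0, j0) (d i0 * A i0 j0 / d j0)) i j
    * (\row_i0 d i0) 0 j) = diag_mx (\row_i d i) *m A.
  by rewrite mul_diag_mx; apply/matrixP => i j; rewrite !mxE mulfVK.
by rewrite mulmxA mulVmx ?mul1mx // diag_mx_unit // => i; rewrite mxE.
Qed.

(** Kolmogorov's criterion is applied to the ratios [A i j / A j i]. In a cycle of length 2 they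
    cancel, and the zero diagonal excludes loops. *)
Lemma reversible_cycles_potential (R : numFieldType) (n : nat) (A : 'M[R]_n) :
    (forall i, A i i = 0) -> (forall i j, 0 <= A i j) ->
    (forall i j, A i j != 0 -> A j i != 0) ->
    (forall c, ucycle (fun i j => A i j != 0) c -> (2 < size c)%N ->
       \prod_(i <- c) A i (next c i) = \prod_(i <- c) A (next c i) i) ->
  exists q : 'I_n -> R,
    (forall i, 0 < q i) /\ (forall i j, q i * A i j = q j * A j i).
Proof.
move=> A0 Age Asym Acyc.
have esym : symmetric (fun i j => A i j != 0).
  by move=> i j; apply/idP/idP; apply: Asym.
have [|c|q [qpos qE]] :=
  @potential_exists R _ _ (fun i j => A i j / A j i) esym.
- move=> i j Aij; have Aji := Asym _ _ Aij.
  by rewrite divr_gt0 // lt_def Age ?Aij ?Aji.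
- case/andP=> cC cU; case: (ltnP 2 (size c)) => [c2|].
    rewrite prodf_div Acyc //; last by rewrite /ucycle cC.
    rewrite divff // prodf_seq_neq0; apply/allP => z zc /=.
    exact/Asym/(next_cycle cC).
  case: c cC cU => [|i [|j []]] //=; rewrite ?andbT.
  + by rewrite big_nil.
  + by rewrite A0 eqxx.
  rewrite inE => /andP[Aij Aji] ij _.
  rewrite !big_cons big_nil /= eqxx (eq_sym j) (negPf ij) eqxx mulr1.
  by rewrite mulrA divfK // divff.
exists q; split=> // i j; case: (eqVneq (A i j) 0) => [Aij|Aij].
  rewrite Aij; case: (eqVneq (A j i) 0) => [->|/Asym]; first by rewrite !mulr0.
  by rewrite Aij eqxx.
by rewrite (qE i j) // mulrA mulfVK // Asym.
Qed.

Lemma ucycle_map_enum_rank (T : finType) (e : rel T) (c : seq T) :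
  ucycle e c ->
  ucycle (fun i j : 'I_#|T| => e (enum_val i) (enum_val j)) (map enum_rank c).
Proof.
case/andP=> cC cU.
rewrite /ucycle map_inj_uniq ?cU ?andbT; last exact: enum_rank_inj.
rewrite cycle_map (eq_cycle (e' := e)) // => x y.
by rewrite /= !enum_rankK.
Qed.

Lemma ucycle_map_enum_val (T : finType) (e : rel T) (c : seq 'I_#|T|) :
  ucycle (fun i j : 'I_#|T| => e (enum_val i) (enum_val j)) c ->
  ucycle e (map enum_val c).
Proof.
case/andP=> cC cU.
rewrite /ucycle map_inj_uniq ?cU ?andbT; last exact: enum_val_inj.
by rewrite cycle_map.
Qed.

Lemma weighted_adjacency_neq0 (R : realType) (V : finType) (E : rel V)
    (w : V -> V -> R) (i j : 'I_#|V|) :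
  arc_weight E w ->
  (weighted_adjacency E w i j != 0) = E (enum_val i) (enum_val j).
Proof. by move=> w0; rewrite mxE; case: ifP => [/w0|_]; rewrite ?eqxx. Qed.

Lemma skew_signing_skew_signed (R : realType) (V : finType) (E : rel V)
    (w w' : V -> V -> R) :
    symmetric_digraph E -> (forall u v, E u v -> 0 < w u v) ->
    skew_signing E w w' ->
  skew_signed (weighted_adjacency E w) (weighted_adjacency E w').
Proof.
move=> Esym wpos [_ ww' w'neg] i j; rewrite !mxE.
set u := enum_val i; set v := enum_val j.
have EE : E v u = E u v by apply/idP/idP; apply: Esym.
rewrite EE; case: ifP => uv; last by rewrite oppr0; left.
have vu : E v u by rewrite EE.
have /wpos/ltW wuv := uv; have /wpos/ltW wvu := vu.
case: (ww' u v uv) (ww' v u vu) (w'neg u v uv) => -> [] -> neg; last 1 first.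
- by move: neg; rewrite mulrNN ltNge mulr_ge0.
- by move: neg; rewrite ltNge mulr_ge0.
- by left.
- by right.
Qed.

(** This lets a statement about all signings of the digraph be used for the flipped matrices. *)
Lemma skew_signed_skew_signing (R : realType) (V : finType) (E : rel V)
    (w : V -> V -> R) (B : 'M[R]_#|V|) :
    symmetric_digraph E -> (forall u v, E u v -> 0 < w u v) ->
    skew_signed (weighted_adjacency E w) B ->
  exists w', skew_signing E w w' /\ weighted_adjacency E w' = B.
Proof.
move=> Esym wpos AB; exists (fun u v => B (enum_rank u) (enum_rank v)).
have AE u v : E u v ->
    weighted_adjacency E w (enum_rank u) (enum_rank v) = w u v.
  by move=> uv; rewrite mxE !enum_rankK uv.
split; last first.
  apply/matrixP => i j; rewrite mxE !enum_valK; case: ifP => // /negbT nE.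
  have A0 : weighted_adjacency E w i j = 0 by rewrite mxE (negPf nE).
  by case: (AB i j) => -[-> _]; rewrite A0 ?oppr0.
split=> u v uv; have vu := Esym _ _ uv.
all: case: (AB (enum_rank u) (enum_rank v)) => -[-> Bvu].
all: rewrite ?Bvu !AE // ?oppr_eq0 ?gt_eqF ?wpos //.
- by left.
- by right.
- by rewrite mulrN oppr_lt0 mulr_gt0 ?wpos.
- by rewrite mulNr oppr_lt0 mulr_gt0 ?wpos.
Qed.

Theorem theorem1p2 (R : realType) (V : finType) (E : rel V)
    (w : V -> V -> R) (hD : pwls_digraph E w) :
  (forall w1 w2 : V -> V -> R,
     skew_signing E w w1 -> skew_signing E w w2 ->
     char_poly (weighted_adjacency E w1) = char_poly (weighted_adjacency E w2))
  <->
  (no_even_cycle_gt2 E /\ positively_symmetrizable (weighted_adjacency E w)).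
Proof.
case: hD => w0 Eirr Esym wpos; set A := weighted_adjacency E w.
have A0 i : A i i = 0 by rewrite mxE (negPf (Eirr _)).
have Age i j : 0 <= A i j by rewrite mxE; case: ifP => // /wpos/ltW.
have An0 i j : (A i j != 0) = E (enum_val i) (enum_val j).
  exact: weighted_adjacency_neq0.
have Asym i j : A i j != 0 -> A j i != 0 by rewrite !An0; apply: Esym.
rewrite positively_symmetrizableP //.
split=> [same|[noC [q [qpos qA]]]]; last first.
  move=> w1 w2 ww1 ww2.
  apply: (@char_poly_skew_signed _ _ A _ _ q).
  - case=> c [cC co c2]; apply: noC; exists (map enum_val c); rewrite size_map.
    split=> //; apply: ucycle_map_enum_val.
    by case/andP: cC => cC cU; rewrite /ucycle cU -(eq_cycle An0) cC.
  - by move=> i; rewrite gt_eqF.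
  - exact: qA.
  - exact: skew_signing_skew_signed.
  - exact: skew_signing_skew_signed.
have cycles := reversible_ucycle _ A0 Age Asym.
(* Statement (i) is carried over from signings of the digraph to matrices. *)
have {}same B1 B2 : skew_signed A B1 -> skew_signed A B2 ->
    char_poly B1 = char_poly B2.
  move=> /(skew_signed_skew_signing Esym wpos)[w1 [ww1 <-]].
  by move=> /(skew_signed_skew_signing Esym wpos)[w2 [ww2 <-]]; apply: same.
split; last first.
  apply: reversible_cycles_potential => // c cC c2.
  by case: (cycles c same cC c2).
case=> c [/ucycle_map_enum_rank cC co c2].
case: (cycles (map enum_rank c) same); rewrite ?size_map ?(negPf co) //.
by case/andP: cC => cC cU; rewrite /ucycle cU (eq_cycle An0) cC.
Qed.
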